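(* Let $f:\mathbb{R}^n\to\mathbb{R}$ be continuously differentiable with a minimizer $x_*$. Suppose that $\nabla f$ is Lipschitz continuous with constant $L>0$ and that $f$ is strongly convex with parameter $\mu>0$. Let $x_0\in\mathbb{R}^n$ be a fixed (deterministic) point, let $(e_k)_{k\ge 0}$ be a sequence of $\mathbb{R}^n$-valued random vectors on a common probability space (not assumed to have zero mean or to be independent), and define $x_{k+1}=x_k-\frac1L\big(\nabla f(x_k)+e_k\big)$ for $k\ge0$. Suppose that $\mathbb{E}[\|e_k\|^2]\le B_k$ for all $k\ge 0$, where $(B_k)_{k\ge0}$ is a (deterministic) sequence of positive real numbers for which the limit of $B_{k+1}/B_k$ exists and $$\lim_{k\to\infty} \frac{B_{k+1}}{B_k}\le 1 .$$ Then for every $\epsilon>0$, $$\mathbb{E}[f(x_k)-f(x_* )]\le (1-\mu/L)^k\,[f(x_0)-f(x_* )]+\mathcal{O}(C_k),\qquad C_k=\max\{B_k,\,(1-\mu/L+\epsilon)^k\},$$ that is, there is a constant $K\ge 0$, independent of $k$, such that $\mathbb{E}[f(x_k)-f(x_* )]\le (1-\mu/L)^k[f(x_0)-f(x_* )]+K C_k$ for all $k\ge 0$.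
   Context: $\|\cdot\|$ is the Euclidean norm on $\mathbb{R}^n$ and $\mathbb{E}$ denotes expectation. Lipschitz continuity of the gradient with constant $L$ means $\|\nabla f(x)-\nabla f(y)\|\le L\|x-y\|$ for all $x,y\in\mathbb{R}^n$. Strong convexity with parameter $\mu$ means $f(y)\ge f(x)+(y-x)^T\nabla f(x)+\frac{\mu}{2}\|y-x\|^2$ for all $x,y\in\mathbb{R}^n$. The iteration is gradient descent with constant step size $1/L$, where the gradient is computed with random residual $e_k$. *)

(* Defs.v *)
From HB Require Import structures.
From mathcomp Require Import all_boot all_order all_algebra.
From mathcomp Require Import all_classical all_reals all_analysis.

Set Implicit Arguments.
Unset Strict Implicit.
Unset Printing Implicit Defensive.

Import Order.TTheory GRing.Theory Num.Theory.
Import numFieldNormedType.Exports.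

Local Open Scope classical_set_scope.
Local Open Scope ring_scope.

Definition dotprod (R : realType) (n : nat) (x y : 'rV[R]_n) : R :=
  \sum_(i < n) x 0 i * y 0 i.

(* The library norm `|x| on 'rV[R]_n is the sup norm. Topology, continuity and
   differentiability do not depend on that choice, but the constants below do. *)
Definition enorm (R : realType) (n : nat) (x : 'rV[R]_n) : R :=
  Num.sqrt (dotprod x x).

(* The directional derivatives 'D_v f x are total functions, so this is
   meaningful only together with differentiability of f at x. *)
Definition grad (R : realType) (n : nat) (f : 'rV[R]_n -> R) (x : 'rV[R]_n)
    : 'rV[R]_n :=
  \row_(i < n) 'D_(delta_mx 0 i) f x.

Definition continuously_differentiable (R : realType) (n : nat)
    (f : 'rV[R]_n -> R) : Prop :=
  (forall x, differentiable f x) /\ continuous (grad f).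

Definition minimizer (R : realType) (n : nat) (f : 'rV[R]_n -> R)
    (xs : 'rV[R]_n) : Prop :=
  forall x, f xs <= f x.

Definition lipschitz_gradient (R : realType) (n : nat) (f : 'rV[R]_n -> R)
    (L : R) : Prop :=
  forall x y, enorm (grad f x - grad f y) <= L * enorm (x - y).

Definition strongly_convex (R : realType) (n : nat) (f : 'rV[R]_n -> R)
    (mu : R) : Prop :=
  forall x y,
    f x + dotprod (y - x) (grad f x) + mu / 2 * enorm (y - x) ^+ 2 <= f y.

(* Measurability with respect to the Borel sigma-algebra of R^n. *)
Definition random_vector (d : measure_display) (T : measurableType d)
    (R : realType) (n : nat) (X : T -> 'rV[R]_n) : Prop :=
  measurable_fun [set: T]
    (X : T -> g_sigma_algebraType (@open 'rV[R]_n)).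

(* Main.v *)
(* The descent inequality and the Polyak-Lojasiewicz inequality give, for each
   outcome, the one-step bound
     f x_{k+1} - f xs <= (1 - mu/L) (f x_k - f xs) + |e_k|^2 / (2L).
   Unrolling it before taking expectations leaves the deterministic recursion
   s_{k+1} = (1 - mu/L) s_k + B_k / (2L), whose growth is governed by the larger
   of B_k and (1 - mu/L + eps)^k. *)
Require Import Defs.
From HB Require Import structures.
From mathcomp Require Import all_boot all_order all_algebra.
From mathcomp Require Import all_classical all_reals all_analysis.
From mathcomp Require Import measurable_realfun ring lra.

Set Implicit Arguments.
Unset Strict Implicit.
Unset Printing Implicit Defensive.

Import Order.TTheory GRing.Theory Num.Theory.
Import numFieldNormedType.Exports.

Local Open Scope classical_set_scope.
Local Open Scope ring_scope.

(** * Euclidean inner product on row vectors *)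

Section dotprod_theory.
Context {R : realType} {n : nat}.
Implicit Types (x y z : 'rV[R]_n) (a : R).

Lemma dotprodC x y : dotprod x y = dotprod y x.
Proof. by apply: eq_bigr => i _; rewrite mulrC. Qed.

Lemma dotprodDl x y z : dotprod (x + y) z = dotprod x z + dotprod y z.
Proof. by rewrite -big_split; apply: eq_bigr => i _; rewrite !mxE mulrDl. Qed.

Lemma dotprodZl a x y : dotprod (a *: x) y = a * dotprod x y.
Proof. by rewrite mulr_sumr; apply: eq_bigr => i _; rewrite !mxE mulrA. Qed.

Lemma dotprodNl x y : dotprod (- x) y = - dotprod x y.
Proof. by rewrite -scaleN1r dotprodZl mulN1r. Qed.

Lemma dotprodDr x y z : dotprod z (x + y) = dotprod z x + dotprod z y.
Proof. by rewrite !(dotprodC z) dotprodDl. Qed.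

Lemma dotprodZr a x y : dotprod x (a *: y) = a * dotprod x y.
Proof. by rewrite !(dotprodC x) dotprodZl. Qed.

Lemma dotprodNr x y : dotprod x (- y) = - dotprod x y.
Proof. by rewrite !(dotprodC x) dotprodNl. Qed.

Definition dotprodE := (dotprodDl, dotprodDr, dotprodNl, dotprodNr,
  dotprodZl, dotprodZr).

Lemma dotprod_ge0 x : 0 <= dotprod x x.
Proof. by apply: sumr_ge0 => i _; rewrite -expr2 sqr_ge0. Qed.

Lemma dotprod_eq0 x : dotprod x x = 0 -> x = 0.
Proof.
move=> /psumr_eq0P x0; apply/rowP => i; rewrite mxE.
have /eqP : x 0 i * x 0 i = 0 by apply: x0 => // j _; rewrite -expr2 sqr_ge0.
by rewrite mulf_eq0 orbb => /eqP.
Qed.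

Lemma enorm_sqr x : enorm x ^+ 2 = dotprod x x.
Proof. by rewrite sqr_sqrtr// dotprod_ge0. Qed.

Lemma dotprod_continuous : continuous (fun x => dotprod x x).
Proof.
apply: continuous_big => [|i _ x]; first exact: add_continuous.
by apply: (@continuousM _ _ (fun x => x 0 i) (fun x => x 0 i));
  exact: coord_continuous.
Qed.

End dotprod_theory.

(** * Inequalities for smooth strongly convex functions *)

Section gradient_inequalities.
Context {R : realType} {n : nat}.
Variables (f : 'rV[R]_n -> R) (L mu : R).
Hypotheses (L_gt0 : 0 < L) (f_lip : lipschitz_gradient f L).
Hypotheses (mu_gt0 : 0 < mu) (f_sc : strongly_convex f mu).

(** Cauchy-Schwarz in disguise: expanding [0 <= |L u - v|^2] and using [|v| <= L |u|] gives
    [2 L (u . v) <= 2 L^2 |u|^2]. *)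
Lemma lipschitz_gradient_dotprod x y :
  dotprod (y - x) (grad f y - grad f x) <= L * dotprod (y - x) (y - x).
Proof.
have : enorm (grad f y - grad f x) ^+ 2 <= (L * enorm (y - x)) ^+ 2.
  by rewrite lerXn2r// nnegrE ?mulr_ge0 ?sqrtr_ge0// ltW.
rewrite exprMn !enorm_sqr.
move: (y - x) (grad f y - grad f x) => u v vL.
have := dotprod_ge0 (L *: u - v); rewrite !dotprodE (dotprodC v u) => uv.
rewrite -(ler_pM2l L_gt0); nra.
Qed.

(** Adding strong convexity from x to y and from y to x bounds the inner product of the previous
    lemma below by [mu |y - x|^2]. *)
Lemma strong_convexity_le_lipschitz (x y : 'rV[R]_n) : x != y -> mu <= L.
Proof.
move=> xy.
have := lipschitz_gradient_dotprod x y.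
have := f_sc x y; have := f_sc y x; rewrite !enorm_sqr.
have : 0 < dotprod (y - x) (y - x).
  rewrite lt_neqAle dotprod_ge0 andbT eq_sym; apply: contra xy => /eqP.
  by move=> /dotprod_eq0/subr0_eq ->.
rewrite -(opprB y x); move: (y - x) => u; rewrite !dotprodE => u0 *.
by rewrite -(ler_pM2r u0); lra.
Qed.

(* Convexity gives the bound with the constant L instead of L / 2; going
   through the midpoint maps a constant c to c / 2 + L / 4, whose fixed point
   is L / 2. *)
Lemma descent_approx k x y :
  f y <= f x + dotprod (y - x) (grad f x)
         + (L / 2 + L / 2 / 2 ^+ k) * dotprod (y - x) (y - x).
Proof.
elim: k x y => [|k IH] x y.
  have := lipschitz_gradient_dotprod x y.
  have := f_sc y x; rewrite !enorm_sqr expr0.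
  have := mulr_ge0 (ltW mu_gt0) (dotprod_ge0 (y - x)).
  rewrite -(opprB y x); move: (y - x) => u; rewrite !dotprodE => *; lra.
pose u := 2^-1 *: (y - x); pose m := x + u.
have yx : y - x = u + u by rewrite -scalerDl -[LHS]scale1r; congr (_ *: _); lra.
have ym : y - m = u by rewrite opprD addrA yx addrK.
have mx : m - x = u by rewrite addrC addKr.
have := IH x m; have := IH m y; have := lipschitz_gradient_dotprod x m.
rewrite ym mx yx exprS invfM !dotprodE; move: (2 ^+ k)^-1 => t *; nra.
Qed.

(** The limit of [descent_approx] as k grows: the excess over [L / 2] is geometric of ratio 1/2. *)
Lemma descent x y :
  f y <= f x + dotprod (y - x) (grad f x) + L / 2 * dotprod (y - x) (y - x).
Proof.
set D := dotprod (y - x) (y - x).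
pose g k := f x + dotprod (y - x) (grad f x) + L / 2 * D
            + geometric (L / 2 * D) 2^-1 k.
have gl : g @ \oo --> f x + dotprod (y - x) (grad f x) + L / 2 * D + 0.
  apply: cvgD; first exact: cvg_cst.
  by apply: cvg_geometric; rewrite ger0_norm ?invr_ge0//; lra.
rewrite addr0 in gl; apply: (cvgr_to_ge gl).
by near=> k; have := descent_approx k x y; rewrite /g /= exprVn -/D; lra.
Unshelve. all: by end_near. Qed.

(** The quadratic lower bound of strong convexity is minimal where [mu (y - x) = - grad f x];
    completing the square there gives the claim. *)
Lemma polyak_lojasiewicz x y :
  2 * mu * (f x - f y) <= dotprod (grad f x) (grad f x).
Proof.
have := ler_wpM2l (ltW mu_gt0) (f_sc x y); rewrite enorm_sqr.
have := dotprod_ge0 (mu *: (y - x) + grad f x); move: (y - x) => u.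
by rewrite !dotprodE (dotprodC (grad f x)) => *; lra.
Qed.

(** For the step 1/L the cross terms [g . e] cancel in the descent inequality, leaving
    [(|e|^2 - |g|^2) / (2 L)]; this is why no assumption on the mean of the residual enters. *)
Lemma gradient_step_le xs x e :
  f (x - L^-1 *: (grad f x + e)) - f xs <=
  (1 - mu / L) * (f x - f xs) + (2 * L)^-1 * dotprod e e.
Proof.
set g := grad f x; set y := x - _.
have yx : y - x = - L^-1 *: (g + e) by rewrite /y addrC addKr scaleNr.
have := descent x y; have := polyak_lojasiewicz x xs.
rewrite yx -/g !dotprodE (dotprodC e g) => pl fy.
rewrite -(ler_pM2l L_gt0); rewrite -(ler_pM2l L_gt0) in fy.
have L0 : L != 0 by rewrite gt_eqF.
have -> : L * ((1 - mu / L) * (f x - f xs) + (2 * L)^-1 * dotprod e e) =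
  L * (f x - f xs) - mu * (f x - f xs) + dotprod e e / 2 by field.
move: fy; set rhs := (X in _ <= X -> _).
have -> : rhs = L * f x + (dotprod e e - dotprod g g) / 2 by rewrite /rhs; field.
by move=> *; lra.
Qed.

End gradient_inequalities.

(** * Growth of deterministic linear recursions with forcing *)

Section perturbed_geometric_recursion.
Context {R : realType}.
Variables (q c : R) (B s : nat -> R).
Hypotheses (q_ge0 : 0 <= q) (c_ge0 : 0 <= c) (B_gt0 : forall k, 0 < B k).
Hypothesis s_step : forall k, s k.+1 = q * s k + c * B k.

(** The finitely many early indices are absorbed one at a time by enlarging K, since C is
    positive. *)
Lemma eventually_bounded_by (C : nat -> R) N K : (forall k, 0 < C k) ->
  0 <= K -> (forall k, (N <= k)%N -> s k <= K * C k) ->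
  exists2 K', 0 <= K' & forall k, s k <= K' * C k.
Proof.
move=> C0; elim: N K => [|N IH] K K0 sK; first by exists K => // k; exact: sK.
apply: (IH (Num.max K (s N / C N))); first by rewrite le_max K0.
move=> k; rewrite leq_eqVlt => /predU1P[<-|/sK].
  by rewrite -ler_pdivrMr// le_max lexx orbT.
by move=> /le_trans; apply; rewrite ler_pM2r// le_max lexx.
Qed.

(** Once [c M <= (r - q) K], the sequence [K D] is a supersolution: [q K D + c M D <= r K D], and D
    grows at least by the factor r. *)
Lemma recursion_dominated (D : nat -> R) r M N : q < r -> 0 <= M ->
  (forall k, 0 < D k) -> (forall k, (N <= k)%N -> r * D k <= D k.+1) ->
  (forall k, (N <= k)%N -> B k <= M * D k) ->
  exists2 K, 0 <= K & forall k, s k <= K * D k.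
Proof.
move=> qr M0 D0 Dr BD.
(* The first term makes the induction step work, the second starts it at N. *)
pose K := Num.max (c * M / (r - q)) (s N / D N).
have K0 : 0 <= K.
  rewrite le_max; apply/orP; left.
  by apply: divr_ge0; [exact: mulr_ge0|rewrite subr_ge0 ltW].
have cK : c * M <= (r - q) * K.
  by rewrite [leRHS]mulrC -ler_pdivrMr ?subr_gt0// le_max lexx.
apply: (@eventually_bounded_by _ N _ D0 K0); elim=> [|k IH].
  by rewrite leqn0 => /eqP <-; rewrite -ler_pdivrMr// le_max lexx orbT.
rewrite leq_eqVlt => /predU1P[<-|].
  by rewrite -ler_pdivrMr// le_max lexx orbT.
rewrite ltnS => Nk; rewrite s_step.
apply: le_trans (ler_wpM2l K0 (Dr k Nk)).
have := ler_wpM2l q_ge0 (IH Nk); have := ler_wpM2l c_ge0 (BD k Nk).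
have := ler_wpM2r (ltW (D0 k)) cK; lra.
Qed.

(* If the ratios B k.+1 / B k tend to l > q then B itself dominates s; otherwise
   l < q + eps, so that B, and hence s, is dominated by (q + eps) ^+ k. *)
Lemma recursion_bound eps : 0 < eps -> cvgn (fun k => B k.+1 / B k) ->
  exists2 K, 0 <= K & forall k, s k <= K * Num.max (B k) ((q + eps) ^+ k).
Proof.
move=> eps0; set l := limn _ => B_cvg.
have p0 : 0 < q + eps by rewrite ltr_wpDl.
suff [D [D0 DC [K K0 sD]]] : exists D : nat -> R, [/\ forall k, 0 < D k,
    forall k, D k <= Num.max (B k) ((q + eps) ^+ k) &
    exists2 K, 0 <= K & forall k, s k <= K * D k].
  by exists K => // k; apply: le_trans (sD k) _; rewrite ler_wpM2l.
have [ql|lq] := ltP q l.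
  exists B; split=> // [k|]; first by rewrite le_max lexx.
  have [N _ BN] := cvgr_gt l B_cvg _ (midf_lt ql).2.
  (* The midpoint of q and l exceeds q and is eventually below the ratios of B. *)
  apply: (@recursion_dominated _ ((q + l) / 2) 1 N) => // [|k Nk|k _].
  - exact: (midf_lt ql).1.
  - by rewrite -ler_pdivlMr// ltW//; exact: BN.
  - by rewrite mul1r.
have lp : l < q + eps by apply: le_lt_trans lq _; rewrite ltrDl.
exists (fun k => (q + eps) ^+ k); split=> [k|k|]; first exact: exprn_gt0.
  by rewrite le_max lexx orbT.
have [N _ BN] := cvgr_lt l B_cvg _ lp.
(* This M makes the geometric sequence agree with B at N; afterwards B grows more slowly. *)
apply: (@recursion_dominated _ (q + eps) (B N / (q + eps) ^+ N) N).
- by rewrite ltrDl.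
- by rewrite divr_ge0 ?exprn_ge0// ltW.
- by move=> k; exact: exprn_gt0.
- by move=> k _; rewrite exprS.
- elim=> [|k IH]; first by rewrite leqn0 => /eqP ->; rewrite divfK ?expf_neq0 ?gt_eqF.
  rewrite leq_eqVlt => /predU1P[->|]; first by rewrite divfK ?expf_neq0 ?gt_eqF.
  rewrite ltnS => Nk; rewrite exprS mulrCA.
  apply: le_trans (ler_wpM2l (ltW p0) (IH Nk)).
  by rewrite -ler_pdivrMr// ltW//; exact: BN.
Qed.

End perturbed_geometric_recursion.

(** * Measurability of the squared residuals and comparison of integrals *)

Section measurability.
Context {d : measure_display} {T : measurableType d} {R : realType}.

Lemma measurable_enorm_sqr n (X : T -> 'rV[R]_n) :
  random_vector X -> measurable_fun setT (fun w => enorm (X w) ^+ 2).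
Proof.
move=> mX; under eq_fun do rewrite enorm_sqr.
apply: (measurability _ (RGenOpens.measurableE R)) => _ [_ [a [b ->]] <-].
rewrite [X in measurable X](_ : _ =
  setT `&` X @^-1` ((fun x => dotprod x x) @^-1` `]a, b[))//.
apply: mX => //; apply: sub_sigma_algebra.
by apply: open_comp; [move=> y _; exact: dotprod_continuous|exact: interval_open].
Qed.

(* The smaller function need not be measurable, because the integral of a
   nonnegative function is a supremum over the simple functions below it. *)
Lemma ge0_le_integralT (m : {measure set T -> \bar R}) (g h : T -> \bar R) :
  (forall w, 0 <= g w)%E -> (forall w, g w <= h w)%E ->
  (\int[m]_w g w <= \int[m]_w h w)%E.
Proof.
move=> g0 gh; rewrite !ge0_integralTE//; last first.
  by move=> w; exact: le_trans (g0 w) (gh w).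
apply: ereal_sup_le => _ [p/= pg <-]; exists p => //= w.
exact: le_trans (pg w) (gh w).
Qed.

End measurability.

(** * Expectation of the unrolled recursion *)

Section expected_recursion.
Context {d : measure_display} {T : measurableType d} {R : realType}.
Variables (P : probability T R) (q a : R).
Hypotheses (q_ge0 : 0 <= q) (a_ge0 : 0 <= a).

(** The forcing b is a parameter so that the same recursion serves per outcome, with squared
    residuals, and deterministically, with their bounds. *)
Fixpoint perturbed_geometric (b : nat -> R) k : R :=
  if k is k'.+1 then q * perturbed_geometric b k' + b k' else a.

Variables (c : R) (X : nat -> T -> R) (B : nat -> R).
Hypotheses (c_ge0 : 0 <= c) (X_ge0 : forall k w, 0 <= X k w).
Hypothesis (mX : forall k, measurable_fun setT (X k)).
Hypothesis (XB : forall k, ('E_P[X k] <= (B k)%:E)%E).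

Let u k w := perturbed_geometric (fun i => c * X i w) k.

Lemma perturbed_geometric_ge0 k w : 0 <= u k w.
Proof. by rewrite /u; elim: k => //= k IH; rewrite addr_ge0// mulr_ge0. Qed.

Lemma measurable_perturbed_geometric k : measurable_fun setT (u k).
Proof.
elim: k => [|k IH]; first exact: measurable_cst.
by apply: measurable_funD; apply: measurable_funM => //; exact: measurable_cst.
Qed.

(** The recursion is linear with nonnegative coefficients, so the integral of nonnegative functions
    passes through it. *)
Lemma expectation_perturbed_geometric k :
  (\int[P]_w (u k w)%:E <= (perturbed_geometric (fun i => c * B i) k)%:E)%E.
Proof.
elim: k => [|k IH].
  rewrite (_ : (fun w => _) = cst a%:E)// integral_cst//=.
  by rewrite probability_setT mule1.
under eq_integral => w _ do rewrite /u /= -/(u k w) EFinD !EFinM.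
have mu_k := measurable_perturbed_geometric k.
have u_ge0 := perturbed_geometric_ge0 k.
rewrite ge0_integralD//=; first last.
- by apply/measurable_EFinP; apply: measurable_funM => //; exact: measurable_cst.
- by move=> w _; rewrite mule_ge0 ?lee_fin.
- by apply/measurable_EFinP; apply: measurable_funM => //; exact: measurable_cst.
- by move=> w _; rewrite mule_ge0 ?lee_fin ?u_ge0.
rewrite ge0_integralZl_EFin//; last 2 first.
- by move=> w _; rewrite lee_fin u_ge0.
- exact/measurable_EFinP.
rewrite ge0_integralZl_EFin//; last 2 first.
- by move=> w _; rewrite lee_fin.
- exact/measurable_EFinP.
rewrite EFinD !EFinM leeD// lee_wpmul2l ?lee_fin//.
by have := XB k; rewrite unlock.
Qed.

End expected_recursion.

Theorem theorem2p3 (R : realType) (n : nat) (f : 'rV[R]_n -> R)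
    (xs : 'rV[R]_n) (L mu : R)
    (d : measure_display) (T : measurableType d) (P : probability T R)
    (x0 : 'rV[R]_n) (e x : nat -> T -> 'rV[R]_n) (B : nat -> R)
    (f_C1 : continuously_differentiable f)
    (f_min : minimizer f xs)
    (L_gt0 : 0 < L) (f_lip : lipschitz_gradient f L)
    (mu_gt0 : 0 < mu) (f_sc : strongly_convex f mu)
    (e_rv : forall k, random_vector (e k))
    (x_init : forall w, x 0%N w = x0)
    (x_step : forall k w,
      x k.+1 w = x k w - L^-1 *: (grad f (x k w) + e k w))
    (B_gt0 : forall k, 0 < B k)
    (e_bound : forall k,
      ('E_P[fun w => (enorm (e k w) ^+ 2)%R] <= (B k)%:E)%E)
    (B_cvg : cvgn (fun k => B k.+1 / B k))
    (B_lim : limn (fun k => B k.+1 / B k) <= 1) :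
  forall eps : R, 0 < eps ->
    exists2 K : R, 0 <= K &
      forall k : nat,
        ('E_P[fun w => (f (x k w) - f xs)%R] <=
          ((1 - mu / L) ^+ k * (f x0 - f xs)
           + K * Num.max (B k) ((1 - mu / L + eps) ^+ k))%R%:E)%E.
Proof.
move=> eps eps0; set q := 1 - mu / L.
have gap_ge0 y : 0 <= f y - f xs by rewrite subr_ge0.
(* For n = 0 nothing relates mu to L and q may be negative, but then R^n is a
   point. *)
have [Lmu|muL] := ltP L mu.
  have xsE y : y = xs.
    apply/eqP/negP => /negP /(strong_convexity_le_lipschitz L_gt0 f_lip f_sc).
    by rewrite leNgt Lmu.
  exists 0 => // k; rewrite unlock (xsE x0) subrr mulr0 add0r mul0r.
  under eq_integral => w _ do rewrite (xsE (x k w)) subrr.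
  by rewrite integral0.
have q_ge0 : 0 <= q by rewrite subr_ge0 ler_pdivrMr// mul1r.
have c_ge0 : 0 <= (2 * L)^-1 by rewrite invr_ge0 mulr_ge0// ltW.
(* Started at 0: by linearity the initial gap contributes exactly [q ^+ k * (f x0 - f xs)], so only
   the forced part s remains to be bounded. *)
pose s := perturbed_geometric q 0 (fun i => (2 * L)^-1 * B i).
have s_step k : s k.+1 = q * s k + (2 * L)^-1 * B k by [].
have [K K0 sK] := recursion_bound q_ge0 c_ge0 B_gt0 s_step eps0 B_cvg.
exists K => // k.
have sE : perturbed_geometric q (f x0 - f xs) (fun i => (2 * L)^-1 * B i) k =
    q ^+ k * (f x0 - f xs) + s k.
  rewrite /s; elim: k => [|k /= ->]; first by rewrite expr0 mul1r addr0.
  by rewrite exprS mulrDr mulrA addrA.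
have gap_le w : f (x k w) - f xs <= perturbed_geometric q (f x0 - f xs)
    (fun i => (2 * L)^-1 * enorm (e i w) ^+ 2) k.
  elim: k {sE} => [|k IH] /=; first by rewrite x_init.
  rewrite x_step enorm_sqr.
  apply: le_trans (gradient_step_le L_gt0 f_lip mu_gt0 f_sc _ _ _) _.
  by rewrite lerD2r ler_wpM2l.
(* The gap is replaced by a bound that is measurable by construction; nonnegativity of the gap
   suffices for the comparison. *)
rewrite unlock; apply: (@le_trans _ _ (\int[P]_w (perturbed_geometric q
    (f x0 - f xs) (fun i => (2 * L)^-1 * enorm (e i w) ^+ 2) k)%:E)%E).
  by apply: ge0_le_integralT => w; rewrite lee_fin// gap_le.
apply: le_trans (expectation_perturbed_geometric q_ge0 (gap_ge0 x0) c_ge0 _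
  (fun k => measurable_enorm_sqr (e_rv k)) e_bound k) _.
  by move=> i w; exact: sqr_ge0.
by rewrite lee_fin sE lerD2l.
Qed.
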